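(* Let $R$ be a ring and let $0\neq e=e^2\in R$. If $R$ is strongly NUS-nil clean, then so is the corner ring $eRe$.
   Context: All rings are associative with identity, not necessarily commutative; $eRe=\{ere : r\in R\}$ is a ring with identity $e$. An element $f$ of a ring $S$ is square-idempotent if $f^2=f^4$. An element $a\in S$ is strongly square-nil clean if $a=f+n$ with $f\in S$ square-idempotent, $n\in S$ nilpotent and $fn=nf$. A ring $S$ is strongly NUS-nil clean if every non-invertible element of $S$ is strongly square-nil clean. *)

(* Defs.v *)
From HB Require Import structures.
From mathcomp Require Import all_boot all_algebra.
From mathcomp Require Import boolp.

Set Implicit Arguments.
Unset Strict Implicit.
Unset Printing Implicit Defensive.

Import GRing.Theory.
Local Open Scope ring_scope.

Section SquareNilClean.
Variable S : pzRingType.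
Implicit Types a f n : S.

(* Two-sided invertibility; the ring is not a unitRingType since invertibility
   need not be decidable. *)
Definition invertible a : Prop := exists b : S, a * b = 1 /\ b * a = 1.

Definition nilpotent_elt n : Prop := exists k : nat, n ^+ k = 0.

Definition square_idempotent f : Prop := f ^+ 2 = f ^+ 4.

Definition strongly_square_nil_clean a : Prop :=
  exists f n : S,
    [/\ a = f + n, square_idempotent f, nilpotent_elt n & f * n = n * f].

Definition strongly_NUS_nil_clean : Prop :=
  forall a : S, ~ invertible a -> strongly_square_nil_clean a.

End SquareNilClean.

Arguments strongly_NUS_nil_clean : clear implicits.

Definition corner_pred (R : pzRingType) (e : R) : {pred R} :=
  fun x => `[< exists r : R, x = e * r * e >].

(* The type eRe depends on the proof that e is idempotent: without it eRe is
   not closed under multiplication and has no identity. *)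
Record corner (R : pzRingType) (e : R) (he : e ^+ 2 = e) : Type := Corner {
  corner_val :> R;
  corner_valP : corner_val \in corner_pred e
}.

Section CornerRing.
Variables (R : pzRingType) (e : R) (he : e ^+ 2 = e).

Lemma cornerP (x : R) :
  reflect (exists r : R, x = e * r * e) (x \in corner_pred e).
Proof. exact: asboolP. Qed.

Fact corner_zmod_closed : zmod_closed (corner_pred e).
Proof.
split; first by apply/cornerP; exists 0; rewrite mulr0 mul0r.
move=> _ _ /cornerP[r ->] /cornerP[s ->]; apply/cornerP.
by exists (r - s); rewrite mulrBr mulrBl.
Qed.
HB.instance Definition _ :=
  GRing.isZmodClosed.Build R (corner_pred e) corner_zmod_closed.

HB.instance Definition _ := [isSub for @corner_val R e he].
HB.instance Definition _ := [Choice of corner he by <:].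
HB.instance Definition _ := [SubChoice_isSubZmodule of corner he by <:].

Fact corner_one_subproof : e \in corner_pred e.
Proof. by apply/cornerP; exists 1; rewrite mulr1 -expr2 he. Qed.

Fact corner_mul_subproof (x y : corner he) :
  (x : R) * (y : R) \in corner_pred e.
Proof.
have /cornerP[r ->] := corner_valP x; have /cornerP[s ->] := corner_valP y.
by apply/cornerP; exists (r * e * e * s); rewrite !mulrA.
Qed.

Definition corner_one : corner he := Corner he corner_one_subproof.
Definition corner_mul (x y : corner he) : corner he :=
  Corner he (corner_mul_subproof x y).

Fact corner_mulA : associative corner_mul.
Proof. by move=> x y z; apply: val_inj; rewrite /= mulrA. Qed.

Fact corner_mul1l : left_id corner_one corner_mul.
Proof.
move=> x; apply: val_inj => /=; have /cornerP[r ->] := corner_valP x.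
by rewrite !mulrA -expr2 he.
Qed.

Fact corner_mul1r : right_id corner_one corner_mul.
Proof.
move=> x; apply: val_inj => /=; have /cornerP[r ->] := corner_valP x.
by rewrite -!mulrA -expr2 he.
Qed.

Fact corner_mulDl : left_distributive corner_mul +%R.
Proof. by move=> x y z; apply: val_inj; rewrite /= mulrDl. Qed.

Fact corner_mulDr : right_distributive corner_mul +%R.
Proof. by move=> x y z; apply: val_inj; rewrite /= mulrDr. Qed.

HB.instance Definition _ := GRing.Zmodule_isPzRing.Build (corner he)
  corner_mulA corner_mul1l corner_mul1r corner_mulDl corner_mulDr.

Lemma corner_val1 : corner_val (1 : corner he) = e. Proof. by []. Qed.

Lemma corner_valM (x y : corner he) :
  corner_val (x * y) = corner_val x * corner_val y.
Proof. by []. Qed.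

Lemma corner_valD (x y : corner he) :
  corner_val (x + y) = corner_val x + corner_val y.
Proof. by []. Qed.

End CornerRing.

(* Main.v *)
Require Import Defs.
From mathcomp Require Import all_boot all_algebra.

(** Let [a] in [eRe] be non-invertible there. It is not invertible in [R]
    either: [a * (1 - e) = 0], so an inverse of [a] would force [e = 1] and
    [eRe = R]. Hence [a = f + n] in [R], with [f ^+ 2 = f ^+ 4], [n] nilpotent
    and [f], [n] commuting. Here [f] need not lie in [eRe]: already [0] is
    [f + (- f)] for every [f] with [f ^+ 2 = 0]. The remedy is to replace [f] by
    [f ^+ 3], which kills such square-zero contributions: [f] and [f ^+ 3] differ
    by an element of square zero, and [f ^+ 3] is again square-idempotent, so that
    [a = f ^+ 3 + ((f - f ^+ 3) + n)] is another decomposition of the same kind.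

    This one lies in [eRe]. Since [f ^+ 3 = f ^+ (3 + 2 * k)] for all [k], and
    [f ^+ m = f ^+ m - (- n) ^+ m] for [m] large, [f ^+ 3] is divisible on both
    sides by [f - (- n) = a] ([cube_multiple_of_sum]), and [a = e * a * e].
    The remaining summand is then in [eRe] as a difference, and nilpotence in
    [R] passes to the corner. *)

Set Implicit Arguments.
Unset Strict Implicit.
Unset Printing Implicit Defensive.

Import GRing.Theory.
Local Open Scope ring_scope.

Section SquareIdempotent.
Variable S : pzRingType.
Implicit Types f n x y : S.

Lemma expr_eq0_leq x k m : x ^+ k = 0 -> (k <= m)%N -> x ^+ m = 0.
Proof. by move=> xk0 lekm; rewrite -(subnKC lekm) exprD xk0 mul0r. Qed.

Lemma nilpotent_eltD x y :
  GRing.comm x y -> nilpotent_elt x -> nilpotent_elt y -> nilpotent_elt (x + y).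
Proof.
move=> cxy [k xk0] [m ym0]; exists (k + m)%N.
rewrite exprDn_comm // big1 // => i _.
(* Each monomial has degree at least [m] in [y] or at least [k] in [x]. *)
case: (leqP m i) => [lemi | ltim].
  by rewrite (expr_eq0_leq ym0 lemi) mulr0 mul0rn.
rewrite (@expr_eq0_leq x k) ?mul0r ?mul0rn //.
by rewrite -addnBA ?leq_addr // ltnW.
Qed.

Lemma square_idempotent_cubeD f k :
  square_idempotent f -> f ^+ (3 + 2 * k) = f ^+ 3.
Proof.
move=> f2; elim: k => [|k IHk]; first by rewrite muln0.
by rewrite mulnS addnCA exprD IHk -exprD (exprD f 4 1) -f2 -exprD.
Qed.

Lemma square_idempotent_cube f :
  square_idempotent f -> square_idempotent (f ^+ 3).
Proof.
move=> f2; rewrite /square_idempotent -!exprM.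
rewrite (exprD f 3 3) (exprD f 9 3).
by rewrite -[9%N]/(3 + 2 * 3)%N square_idempotent_cubeD.
Qed.

Lemma square_idempotent_subr_cube f :
  square_idempotent f -> (f - f ^+ 3) ^+ 2 = 0.
Proof.
move=> f2; have f6 : f ^+ 6 = f ^+ 2.
  by rewrite (exprD f 4 2) -f2 -exprD -f2.
rewrite expr2 mulrBl !mulrBr -expr2 -exprS -exprSr -exprD f6 -f2.
by rewrite !subrr.
Qed.

(** [f ^+ m - (- n) ^+ m] has the factor [f + n] on either side, and for large
    odd [m] it equals [f ^+ 3]. *)
Lemma cube_multiple_of_sum f n :
    square_idempotent f -> nilpotent_elt n -> GRing.comm f n ->
  exists s, f ^+ 3 = (f + n) * s /\ f ^+ 3 = s * (f + n).
Proof.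
move=> f2 [k nk0] cfn; have cfN : GRing.comm f (- n) by apply: commrN.
pose m := (3 + 2 * k)%N.
have Nm0 : (- n) ^+ m = 0.
  rewrite exprNn (@expr_eq0_leq n k) ?mulr0 //.
  by rewrite /m mul2n -addnn addnA leq_addl.
pose s := \sum_(i < m) f ^+ (m.-1 - i) * (- n) ^+ i.
have f3 : f ^+ 3 = (f + n) * s.
  rewrite -(square_idempotent_cubeD k f2) -/m -[LHS]subr0 -Nm0.
  by rewrite subrXX_comm // opprK.
exists s; split=> //; rewrite f3.
apply: commr_sum => i _; apply: commrM; apply: commrX.
  by apply/commr_sym/commrD.
by apply/commrN/commr_sym/commrD => //; apply: commr_sym.
Qed.

End SquareIdempotent.

Section Corner.
Variables (R : pzRingType) (e : R) (he : e ^+ 2 = e).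
Implicit Types x : corner he.

Lemma corner_mull x : e * corner_val x = corner_val x.
Proof. by rewrite -[in RHS](mul1r x). Qed.

Lemma corner_mulr x : corner_val x * e = corner_val x.
Proof. by rewrite -[in RHS](mulr1 x). Qed.

(** The factor [e] only matters for [k = 0], where the two units differ. *)
Lemma corner_valX x k : corner_val (x ^+ k) = e * corner_val x ^+ k.
Proof.
elim: k => [|k IHk]; first by rewrite !expr0 mulr1.
by rewrite !exprSr corner_valM IHk mulrA.
Qed.

Lemma nilpotent_elt_corner x :
  nilpotent_elt (corner_val x) -> nilpotent_elt x.
Proof.
by case=> k xk0; exists k; apply: val_inj; rewrite /= corner_valX xk0 mulr0.
Qed.

Lemma square_idempotent_corner x :
  square_idempotent (corner_val x) -> square_idempotent x.
Proof.
move=> x2; apply: val_inj.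
rewrite -[LHS]/(corner_val (x ^+ 2)) -[RHS]/(corner_val (x ^+ 4)).
by rewrite 2!corner_valX x2.
Qed.

Lemma invertible_corner x : invertible (corner_val x) -> invertible x.
Proof.
case=> b [xb bx].
have e1 : e = 1 by rewrite -[e]mul1r -bx -mulrA corner_mulr.
have b_corner : b \in corner_pred e.
  by apply/cornerP; exists b; rewrite e1 mul1r mulr1.
by exists (Corner he b_corner); split; apply: val_inj;
  rewrite /= ?xb ?bx -e1.
Qed.

Lemma strongly_square_nil_clean_corner x :
  strongly_square_nil_clean (corner_val x) -> strongly_square_nil_clean x.
Proof.
case=> f [n [xfn f2 n_nil cfn]].
have [s [f3l f3r]] := cube_multiple_of_sum f2 n_nil cfn.
have f3_corner : f ^+ 3 \in corner_pred e.
  have ef3 : e * f ^+ 3 = f ^+ 3 by rewrite f3l -xfn mulrA corner_mull.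
  have f3e : f ^+ 3 * e = f ^+ 3 by rewrite f3r -xfn -mulrA corner_mulr.
  by apply/cornerP; exists (f ^+ 3); rewrite ef3 f3e.
pose g := Corner he f3_corner.
have xBg : corner_val (x - g) = (f - f ^+ 3) + n.
  by rewrite -[LHS]/(corner_val x - f ^+ 3) xfn addrAC.
have cf_f3 : GRing.comm (f ^+ 3) f by apply/commr_sym/commrX.
have cn_f3 : GRing.comm n (f ^+ 3) by apply: commrX.
exists g, (x - g); split.
- by rewrite addrC subrK.
- exact/square_idempotent_corner/square_idempotent_cube.
- apply: nilpotent_elt_corner; rewrite xBg.
  apply: nilpotent_eltD => //; last first.
    by exists 2%N; apply: square_idempotent_subr_cube.
  by apply/commr_sym/commrB.
- apply: val_inj.
  rewrite -[LHS]/(f ^+ 3 * corner_val (x - g)).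
  rewrite -[RHS]/(corner_val (x - g) * f ^+ 3) xBg.
  by apply: commrD; [apply: commrB | apply: commr_sym].
Qed.

End Corner.

Theorem lemma2p8 (R : pzRingType) (e : R) (he : e ^+ 2 = e) (e_neq0 : e <> 0) :
  strongly_NUS_nil_clean R -> strongly_NUS_nil_clean (corner he).
Proof.
move=> cleanR x x_ninv; apply/strongly_square_nil_clean_corner/cleanR.
by move=> /invertible_corner.
Qed.
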